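(* One has the asymptotic expansion $$\Pi(x)\sim\sum_{n=1}^\infty\frac1n\pi(\sqrt[n]{x})\quad(x\to\infty).$$
   Context: $\pi(x)$ is the number of primes $p\le x$, and $\Pi(x)=\sum_{n=1}^\infty\frac1n\pi(\sqrt[n]{x})=\sum_{n=1}^\infty\sum_{p^n\le x}\frac1n$ for $x>0$ is the Riemann prime counting function (for each $x$ the sum over $n$ is finite). The asymptotic expansion is with respect to the asymptotic sequence $\{\pi(\sqrt[n]{x})\}_{n\ge1}$; that is, it means that for every $N\ge1$, $\Pi(x)-\sum_{n=1}^N\frac1n\pi(\sqrt[n]{x})=o(\pi(\sqrt[N]{x}))$ as $x\to\infty$. *)

(* Defs.v *)
From HB Require Import structures.
From mathcomp Require Import all_boot all_order all_algebra.
From mathcomp Require Import finmap.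
From mathcomp Require Import all_classical all_reals all_analysis.
Set Implicit Arguments.
Unset Strict Implicit.
Unset Printing Implicit Defensive.
Import Order.TTheory GRing.Theory Num.Theory.
Import numFieldNormedType.Exports.
Local Open Scope classical_set_scope.
Local Open Scope ring_scope.

(* The set is always finite, so [fset_set] does not collapse it to the empty
   set. *)
Definition primepi (R : realType) (x : R) : nat :=
  #|` fset_set [set p : nat | prime p /\ p%:R <= x] |.

(* [powR] is the usual real power for a positive base, the only case that
   matters for n >= 1 and x > 0. *)
Definition nroot (R : realType) (n : nat) (x : R) : R := x `^ n%:R^-1.

(* The real-valued infinite sum is the limit of its partial sums.  For x > 0 it
   always converges: its terms vanish as soon as x < 2 ^ n. *)
Definition riemannPi (R : realType) (x : R) : R :=
  \big[+%R/(0 : R)]_(1 <= n <oo) (n%:R^-1 * (primepi (nroot n x))%:R).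

(* Lets the little-o notation be used at +oo. *)
Canonical pinfty_filter_on (R : numFieldType) :=
  FilterType (pinfty_nbhs R) _.

(* f(x) ~ \sum_(n >= 1) a_n phi_n(x) as x -> +oo, with respect to
   (phi_n)_(n >= 1).  The expansion is formal: no convergence is involved. *)
Definition asymptotic_expansion (R : realType)
    (f : R -> R) (a : nat -> R) (phi : nat -> R -> R) : Prop :=
  forall N : nat, (1 <= N)%N ->
    (fun x : R => f x - \sum_(1 <= n < N.+1) a n * phi n x) =o_+oo phi N.

(* Main.v *)
Require Import Defs.
From mathcomp Require Import all_boot all_order all_algebra.
From mathcomp Require Import all_classical all_reals all_analysis.
From mathcomp Require Import ring lra zify.
Set Implicit Arguments.
Unset Strict Implicit.
Unset Printing Implicit Defensive.
Import Order.TTheory GRing.Theory Num.Theory.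
Import numFieldNormedType.Exports.
Local Open Scope ring_scope.

(** For fixed [x] the series defining Pi is a finite sum: its [n]-th term
    vanishes once [x < 2 ^ n], because the [n]-th root of [x] is then below the
    first prime.  So the error after [N] terms is a sum of at most
    [ln x / ln 2] terms, each at most the [N.+1]-st root of [x]
    ([riemannPi_tail_le]).

    This has to be negligible against [primepi y], where [y] is the [N]-th root
    of [x].  The [N.+1]-st root of [x] is [y] to the power [N / N.+1], so a lower
    bound for [primepi y] of the order of [y / ln y] suffices, the logarithms
    being absorbed by the remaining power [1 / N.+1] of [y].

    The lower bound is Chebyshev's ([primepi_chebyshev]), from the size of a
    central binomial coefficient: with [m] the half of [n], the binomial
    'C(n, m) is at least [2 ^ m], while each prime power dividing it is at most
    [n] ([logn_bin_le]), so that it is at most [n] to the number of primes up to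
    [n]. *)

(** * A Chebyshev lower bound for the number of primes *)

(** Legendre's formula sums up to a bound depending on [j]; this lets the
    formulas for the three factorials of a binomial coefficient share one
    range. *)
Lemma sum_divn_expn_widen (p j a b : nat) :
  (1 < p)%N -> (j < p ^ a.+1)%N -> (a <= b)%N ->
  (\sum_(1 <= k < a.+1) j %/ p ^ k = \sum_(1 <= k < b.+1) j %/ p ^ k)%N.
Proof.
move=> p1 jp ab; rewrite [RHS](@big_cat_nat _ _ _ a.+1) //=.
rewrite [X in (_ + X)%N]big_nat_cond.
rewrite [X in (_ + X)%N]big1 ?addn0 // => k; rewrite andbT => /andP[ak _].
by rewrite divn_small // (leq_trans jp) // leq_exp2l.
Qed.

(** By Legendre's formula the valuation is the sum, over the [k] with
    [p ^ k <= n], of the carries [n %/ p ^ k - m %/ p ^ k - (n - m) %/ p ^ k],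
    and each of these is 0 or 1. *)
Lemma logn_bin_le (p n m : nat) : prime p -> (m <= n)%N ->
  (logn p 'C(n, m) <= trunc_log p n)%N.
Proof.
move=> pp mn; have p1 := prime_gt1 pp; pose t := trunc_log p n.
have fE j : (j <= n)%N -> (logn p j`! = \sum_(1 <= k < t.+1) j %/ p ^ k)%N.
  move=> jn; rewrite logn_fact // (@sum_divn_expn_widen _ _ _ (maxn j t)) //.
  - rewrite [RHS](@sum_divn_expn_widen _ _ _ (maxn j t)) ?leq_maxr //.
    by rewrite (leq_ltn_trans jn) // trunc_log_ltn.
  - by rewrite (ltn_trans (ltnSn j)) // ltn_expl.
  - by rewrite leq_maxl.
rewrite -(leq_add2r (logn p (m`! * (n - m)`!))).
rewrite -lognM ?bin_gt0 ?muln_gt0 ?fact_gt0 // bin_fact //.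
rewrite lognM ?fact_gt0 // !fE ?leq_subr // -/t.
have -> : (t + (\sum_(1 <= k < t.+1) m %/ p ^ k +
               \sum_(1 <= k < t.+1) (n - m) %/ p ^ k) =
  \sum_(1 <= k < t.+1) (1 + (m %/ p ^ k + (n - m) %/ p ^ k)))%N.
  by rewrite !big_split /= sum_nat_const_nat subn1 muln1.
apply: leq_sum => k _; rewrite -{1}(subnKC mn) divnD ?expn_gt0 ?prime_gt0 //.
by rewrite addnC leq_add2r leq_b1.
Qed.

Lemma prime_dvd_fact_le (p n : nat) : prime p -> (p %| n`!)%N -> (p <= n)%N.
Proof.
move=> pp; elim: n => [|n IH]; first by rewrite dvdn1 => /eqP p1; rewrite p1 in pp.
rewrite factS Euclid_dvdM // => /orP[/dvdn_leq->//|/IH/leqW//].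
Qed.

(** In the factorisation of the binomial coefficient each prime power is at
    most [n] by [logn_bin_le], and the primes that occur divide [n`!]. *)
Lemma bin_le_expn_primes (n m : nat) : (0 < n)%N ->
  ('C(n, m) <= n ^ count prime (iota 1 n))%N.
Proof.
move=> n0; have [mn|nm] := leqP m n; last by rewrite bin_small.
have C0 : (0 < 'C(n, m))%N by rewrite bin_gt0.
rewrite {1}(prod_prime_decomp C0) prime_decompE big_map /=.
apply: (@leq_trans (\prod_(p <- primes 'C(n, m)) n)%N).
  rewrite big_seq [leqRHS]big_seq; apply: leq_prod => p.
  rewrite mem_primes => /andP[pp _].
  apply: (@leq_trans (p ^ trunc_log p n)).
    by rewrite leq_exp2l ?prime_gt1 ?logn_bin_le.
  by rewrite trunc_logP ?prime_gt1.
rewrite big_const_seq count_predT iter_muln_1 leq_pexp2l //.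
rewrite -size_filter uniq_leq_size ?primes_uniq // => p.
rewrite mem_primes mem_filter mem_iota /= ltnS => /and3P[pp _ pC].
rewrite pp prime_gt0 //= (@prime_dvd_fact_le _ n) //.
by rewrite -(bin_fact mn) dvdn_mulr.
Qed.

Lemma expn2_le_bin (m : nat) : (2 ^ m <= 'C(m.*2, m))%N.
Proof.
elim: m => [|m IH]; first by rewrite bin0.
rewrite doubleS binS expnS mul2n -addnn leq_add //.
  by rewrite (leq_trans IH) // binS leq_addl.
by rewrite (leq_trans IH) // leq_bin2l.
Qed.

(** * The function primepi *)

Lemma primepiE (R : realType) (y : R) : 0 <= y ->
  primepi y = count prime (iota 1 (Num.truncn y)).
Proof.
move=> y0; rewrite /primepi -size_filter.
set A := [set p : nat | _]%classic.
have Afin : finite_set A.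
  apply: (sub_finite_set _ (finite_II (Num.truncn y).+1)) => p /= [_ py].
  by rewrite ltnS truncn_ge_nat.
apply/perm_size/uniq_perm; rewrite ?filter_uniq ?iota_uniq ?finmap.fset_uniq //.
move=> p; rewrite (in_fset_set Afin) mem_filter mem_iota add1n ltnS.
apply/idP/idP => [/set_mem[pp py]|/and3P[pp _ py]].
  by rewrite pp prime_gt0 //= truncn_ge_nat.
by apply/mem_set; split=> //; rewrite -truncn_ge_nat.
Qed.

Lemma primepi_le (R : realType) (y : R) : 0 <= y -> (primepi y)%:R <= y.
Proof.
move=> y0; rewrite primepiE // -truncn_ge_nat //.
by rewrite (leq_trans (count_size _ _)) // size_iota.
Qed.

Lemma primepi_lt2 (R : realType) (y : R) : 0 <= y -> y < 2 -> primepi y = 0%N.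
Proof.
move=> y0 y2; have := truncn_lt_nat 2 y0; rewrite y2 primepiE //.
by case: (Num.truncn y) => [|[|]].
Qed.

(** Taking logarithms in [2 ^ n./2 <= 'C(n, n./2) <= n ^ primepi y], with [n] the
    integer part of [y].  The condition [4 <= y] pays for the two roundings in
    [y / 4 <= n./2]. *)
Lemma primepi_chebyshev (R : realType) (y : R) : 4 <= y ->
  y * ln 2 <= 4 * (primepi y)%:R * ln y.
Proof.
move=> y4; have y0 : 0 <= y by lra.
set n := Num.truncn y; set P := primepi y.
have ny : n%:R <= y by rewrite -truncn_ge_nat.
have yn : y < n.+1%:R by rewrite truncnS_gt.
have n4 : (4 <= n)%N by rewrite truncn_ge_nat.
have pow : (2 ^ n./2 <= n ^ P)%N.
  rewrite /P primepiE // (leq_trans (expn2_le_bin _)) //.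
  rewrite (@leq_trans 'C(n, n./2)) ?bin_le_expn_primes //; last by lia.
  by rewrite leq_bin2l //; lia.
have l2 : 0 <= ln 2 :> R by rewrite ln_ge0 // ler1n.
have lpow : n./2%:R * ln 2 <= P%:R * ln n%:R :> R.
  rewrite !mulr_natl -!lnXn ?ltr0n //; last by lia.
  by rewrite ler_ln ?posrE ?exprn_gt0 ?ltr0n -?natrX ?ler_nat //; lia.
have ln_le : ln n%:R <= ln y by rewrite ler_ln ?posrE ?ltr0n //; [lia|lra].
have half : y <= 4 * n./2%:R.
  have : n.+1%:R <= 2 * n./2%:R + 2 :> R by rewrite -natrM -natrD ler_nat; lia.
  lra.
have P0 : 0 <= P%:R :> R by [].
have := ler_wpM2l P0 ln_le; have := ler_wpM2r l2 half; lra.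
Qed.

(** * Real roots *)

Lemma nroot_ge0 (R : realType) (n : nat) (x : R) : 0 <= nroot n x.
Proof. exact: powR_ge0. Qed.

Lemma nrootK (R : realType) (n : nat) (x : R) : (0 < n)%N -> 0 <= x ->
  nroot n x ^+ n = x.
Proof.
move=> n0 x0; rewrite -powR_mulrn ?nroot_ge0 // -powRrM mulVf ?powRr1 //.
by rewrite pnatr_eq0 -lt0n.
Qed.

Lemma nroot_exprn (R : realType) (n : nat) (r : R) : (0 < n)%N -> 0 <= r ->
  nroot n (r ^+ n) = r.
Proof.
move=> n0 r0; rewrite /nroot -powR_mulrn // -powRrM mulfV ?powRr1 //.
by rewrite pnatr_eq0 -lt0n.
Qed.

Lemma le_nroot (R : realType) (m n : nat) (x : R) : 1 <= x ->
  (0 < m)%N -> (m <= n)%N -> nroot n x <= nroot m x.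
Proof.
move=> x1 m0 mn; apply: ler_powR => //.
by rewrite lef_pV2 ?posrE ?ltr0n ?ler_nat //; lia.
Qed.

(** * The tail of the series *)

Lemma primepi_nroot_eq0 (R : realType) (n : nat) (x : R) : 0 <= x ->
  (0 < n)%N -> x < 2 ^+ n -> primepi (nroot n x) = 0%N.
Proof.
move=> x0 n0 xn; apply: primepi_lt2; first exact: nroot_ge0.
by rewrite -(@ltr_pXn2r _ n) ?nnegrE ?nroot_ge0 // nrootK.
Qed.

Lemma riemannPi_finite (R : realType) (K : nat) (x : R) : 0 <= x ->
  (0 < K)%N -> x < 2 ^+ K ->
  riemannPi x = \sum_(1 <= n < K) n%:R^-1 * (primepi (nroot n x))%:R.
Proof.
move=> x0 K0 xK; apply: lim_near_cst; first exact: norm_hausdorff.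
exists K => // n /= Kn; rewrite (@big_cat_nat _ _ _ K) //=.
rewrite [X in _ + X]big_nat_cond [X in _ + X]big1 ?addr0 // => k.
rewrite andbT => /andP[Kk _].
rewrite primepi_nroot_eq0 ?mulr0 ?(leq_trans K0) // (lt_le_trans xK) //.
by rewrite ler_weXn2l // ler1n.
Qed.

(** The tail has at most [ln x / ln 2] nonzero terms, and each is at most
    [nroot N.+1 x] by the trivial bound [primepi y <= y]. *)
Lemma riemannPi_tail_le (R : realType) (N : nat) (x : R) : 1 <= x ->
  `|riemannPi x - \sum_(1 <= n < N.+1) n%:R^-1 * (primepi (nroot n x))%:R|
    <= ln x / ln 2 * nroot N.+1 x.
Proof.
move=> x1; have x0 : 0 < x by lra.
have l2 : 0 < ln 2 :> R by rewrite ln_gt0 // ltr1n.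
have r0 : 0 <= ln x / ln 2 by rewrite divr_ge0 ?(ltW l2) ?ln_ge0.
set k := Num.truncn (ln x / ln 2).
have xk : x < 2 ^+ k.+1.
  rewrite -ltr_ln ?posrE ?exprn_gt0 // lnXn // -[ltRHS]mulr_natl -ltr_pdivrMr //.
  exact: truncnS_gt.
(* The maximum covers the case where already the retained terms go beyond the
   last nonzero one. *)
set K := maxn k.+1 N.+1.
have xK : x < 2 ^+ K by rewrite (lt_le_trans xk) // ler_weXn2l ?ler1n ?leq_maxl.
rewrite (@riemannPi_finite _ K) ?(ltW x0) ?leq_max //.
rewrite (@big_cat_nat _ _ _ N.+1 1 K) ?leq_maxr //= addrAC subrr add0r.
rewrite ger0_norm; last by apply: sumr_ge0 => i _; rewrite mulr_ge0 ?invr_ge0.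
apply: (@le_trans _ _ (\sum_(N.+1 <= n < K) nroot N.+1 x)).
  rewrite big_nat_cond [leRHS]big_nat_cond; apply: ler_sum => n.
  rewrite andbT => /andP[Nn _]; have n0 : (0 < n)%N by rewrite (leq_trans _ Nn).
  apply: (@le_trans _ _ (nroot n x)); last exact: le_nroot.
  apply: (@le_trans _ _ (primepi (nroot n x))%:R); last first.
    exact/primepi_le/nroot_ge0.
  by rewrite ler_piMl // invf_le1 ?ltr0n // ler1n.
rewrite sumr_const_nat -[leLHS]mulr_natl ler_wpM2r ?nroot_ge0 //.
by rewrite -truncn_ge_nat // -/k /K; lia.
Qed.

(** * Comparison of the tail with the last retained term *)

(** The substitution [x = z ^+ (3 * N * N.+1)] turns every quantity into a
    power of [z]: the [N]-th root of [x] is [z ^+ (3 * N + 3)], the [N.+1]-st is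
    [z ^+ (3 * N)], and each of the two logarithms, one in the length of the
    tail and one in the Chebyshev bound, costs at most one factor [z].  The
    factor 3 in the exponent leaves one power of [z] to spare. *)
Lemma riemannPi_tail_le_primepi (R : realType) (N : nat) (x z : R) :
    (0 < N)%N -> 4 <= z -> x = z ^+ (3 * (N * N.+1)) ->
  `|riemannPi x - \sum_(1 <= n < N.+1) n%:R^-1 * (primepi (nroot n x))%:R|
      * (z * ln 2 ^+ 2)
    <= (3 * (N * N.+1))%:R * (12 * N.+1%:R) * (primepi (nroot N x))%:R.
Proof.
move=> N0 z4; set l : R := ln 2; set M := (3 * (N * N.+1))%N => xz.
have l0 : 0 < l by rewrite ln_gt0 // ltr1n.
have z0 : 0 < z by lra.
have lnz : ln z <= z by rewrite ltW // ln_sublinear.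
have x1 : 1 <= x by rewrite xz exprn_ege1 //; lra.
have rN : nroot N x = z ^+ (3 * N.+1).
  rewrite xz /M (_ : 3 * (N * N.+1) = 3 * N.+1 * N)%N; last by lia.
  by rewrite [z ^+ (_ * N)]exprM nroot_exprn // exprn_ge0 // ltW.
have rN1 : nroot N.+1 x = z ^+ (3 * N).
  rewrite xz /M (_ : 3 * (N * N.+1) = 3 * N * N.+1)%N; last by lia.
  by rewrite [z ^+ (_ * N.+1)]exprM nroot_exprn // exprn_ge0 // ltW.
have zl : 0 <= z * l ^+ 2 by rewrite mulr_ge0 ?exprn_ge0 ?ltW.
apply: le_trans (ler_wpM2r zl (riemannPi_tail_le N x1)) _; rewrite rN1 rN.
have : 4 <= z ^+ (3 * N.+1).
  by rewrite (le_trans z4) // -[leLHS]expr1 ler_weXn2l //; lra.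
move/primepi_chebyshev; rewrite lnXn // -/l.
set P : R := (primepi _)%:R => cheb; have P0 : 0 <= P by [].
(* [ln (z ^+ (3 * N.+1)) <= 3 * N.+1 * z], and one power of [z] cancels. *)
have {}cheb : z ^+ (3 * N) * z ^+ 2 * l <= 12 * N.+1%:R * P.
  rewrite -(ler_pM2r z0).
  have -> : z ^+ (3 * N) * z ^+ 2 * l * z = z ^+ (3 * N.+1) * l.
    by rewrite mulnS addnC exprD; ring.
  apply: (le_trans cheb); rewrite -[ln z *+ _]mulr_natl natrM.
  have := ler_wpM2l (mulr_ge0 (ler0n R N.+1) P0) lnz; lra.
have lnx : ln x <= M%:R * z.
  by rewrite xz lnXn // -[leLHS]mulr_natl ler_wpM2l.
have -> : ln x / l * z ^+ (3 * N) * (z * l ^+ 2) =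
          ln x * (z ^+ (3 * N) * z * l) by field; rewrite gt_eqF.
apply: (@le_trans _ _ (M%:R * (z ^+ (3 * N) * z ^+ 2 * l))).
  have zzl : 0 <= z ^+ (3 * N) * z * l by rewrite !mulr_ge0 ?exprn_ge0 ?ltW.
  apply: le_trans (ler_wpM2r zzl lnx) _.
  by rewrite expr2 !mulrA [M%:R * z * _]mulrAC.
by rewrite -[leRHS]mulrA ler_wpM2l.
Qed.

Theorem proposition2p1 (R : realType) :
  asymptotic_expansion (@riemannPi R) (fun n : nat => n%:R^-1)
    (fun (n : nat) (x : R) => (primepi (nroot n x))%:R).
Proof.
move=> N N0; apply/eqoP => e e0.
set M := (3 * (N * N.+1))%N; have M0 : (0 < M)%N by rewrite /M; lia.
set C : R := M%:R * (12 * N.+1%:R).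
have l2 : 0 < ln 2 ^+ 2 :> R by rewrite exprn_gt0 // ln_gt0 // ltr1n.
(* The relative error is at most [C / (z * ln 2 ^+ 2)], hence at most [e] as
   soon as [z >= C / (e * ln 2 ^+ 2)]. *)
set A := Num.max 4 (C / (e * ln 2 ^+ 2)).
apply: filterS (nbhs_pinfty_ge (num_real (A ^+ M))) => x xA.
have A4 : 4 <= A by rewrite le_max lexx.
have A0 : 0 <= A by lra.
have x0 : 0 <= x by rewrite (le_trans _ xA) // exprn_ge0.
set z := nroot M x; have z0 : 0 <= z by exact: nroot_ge0.
have xz : x = z ^+ M by rewrite nrootK.
have Az : A <= z by rewrite -(@ler_pXn2r _ M) ?nnegrE // -xz.
have z4 : 4 <= z by lra.
have zl : 0 < z * ln 2 ^+ 2 by rewrite mulr_gt0 //; lra.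
have tail := riemannPi_tail_le_primepi N0 z4 xz.
rewrite -(ler_pM2r zl); apply: (le_trans tail).
rewrite (ger0_norm (ler0n _ _)) [leRHS]mulrAC ler_wpM2r // -/C.
have el : 0 < e * ln 2 ^+ 2 by exact: mulr_gt0.
rewrite mulrCA mulrC -ler_pdivrMl // mulrC.
by rewrite (le_trans _ Az) // le_max lexx orbT.
Qed.
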